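(* Let $G=(V,E)$ be a finite graph, let $d\in(0,\infty)$ and $K\in\mathbb{R}$. If $G$ satisfies the $CDE'(d,K)$ inequality, then $G$ also satisfies the $CD(d,K)$ condition.
   Context: A finite graph is a pair $G=(V,E)$ with $V$ a finite set and $E\subset V\times V$ a symmetric relation with $(v,v)\notin E$ for all $v$; write $v\sim w$ if $(v,w)\in E$. Let $C(V)=\mathbb{R}^V$ and $C^+(V)=\{f:V\to(0,\infty)\}$. Operations on functions on $V$ and inequalities between them are pointwise. Laplacian: $\Delta f(v)=\sum_{w\sim v}(f(w)-f(v))$ for $f\in C(V)$. Gradient forms: for $f,g\in C(V)$, $2\Gamma(f,g)=\Delta(fg)-f\Delta g-g\Delta f$ and $2\Gamma_2(f,g)=\Delta\Gamma(f,g)-\Gamma(f,\Delta g)-\Gamma(g,\Delta f)$; $\Gamma(f)=\Gamma(f,f)$, $\Gamma_2(f)=\Gamma_2(f,f)$. For $f\in C^+(V)$, $\widetilde{\Gamma}_2(f)=\Gamma_2(f)-\Gamma\left(f,\frac{\Gamma(f)}{f}\right)$. $CDE'(d,K)$: $G$ satisfies it if for all $f\in C^+(V)$, $\widetilde{\Gamma}_2(f)\ge\frac1d f^2(\Delta\log f)^2+K\Gamma(f)$. $CD(d,K)$: $G$ satisfies it if for all $f\in C(V)$, $\Gamma_2(f)\ge\frac1d(\Delta f)^2+K\Gamma(f)$. *)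

(* Defs.v *)
From mathcomp Require Import all_boot all_order all_algebra.
From mathcomp Require Import reals exp.

Set Implicit Arguments.
Unset Strict Implicit.
Unset Printing Implicit Defensive.

Import Order.TTheory GRing.Theory Num.Theory.

Local Open Scope ring_scope.

Section GraphCurvature.
Context {R : realType} {V : finType} (E : rel V).
Implicit Types f g : V -> R.

Definition laplacian f (v : V) : R := \sum_(w | E v w) (f w - f v).

Definition Gamma f g (v : V) : R :=
  (laplacian (fun u => f u * g u) v
     - f v * laplacian g v - g v * laplacian f v) / 2.

Definition Gamma2 f g (v : V) : R :=
  (laplacian (Gamma f g) v
     - Gamma f (laplacian g) v - Gamma g (laplacian f) v) / 2.

(* Only meaningful for pointwise positive f, because of the division. *)
Definition tGamma2 f (v : V) : R :=
  Gamma2 f f v - Gamma f (fun u => Gamma f f u / f u) v.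

Definition CDE' (d K : R) : Prop :=
  forall f, (forall v, 0 < f v) ->
  forall v, tGamma2 f v >=
    1 / d * f v ^+ 2 * laplacian (fun u => ln (f u)) v ^+ 2 + K * Gamma f f v.

Definition CD (d K : R) : Prop :=
  forall f v,
    Gamma2 f f v >= 1 / d * laplacian f v ^+ 2 + K * Gamma f f v.

End GraphCurvature.

(* Main.v *)
Require Import Defs.
From mathcomp Require Import all_boot all_order all_algebra.
From mathcomp Require Import reals exp.
From mathcomp Require Import ring lra.
From mathcomp Require Import classical_sets filter topology normedtype.

(** The inequality CD(d, K) is the linearization of CDE'(d, K) at the constant
function 1.  Let f be any function and let e > 0 be small enough that 1 + e f
is positive.  The Laplacian, Gamma and Gamma2 ignore constants and are
respectively linear, bilinear and bilinear, so CDE' for 1 + e f, divided by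
e^2, reads

  Gamma2(f) - e Gamma(f, Gamma(f) / (1 + e f))
    >= (1/d) (1 + e f)^2 (Delta (log(1 + e f) / e))^2 + K Gamma(f)

(lemma [CDE'_perturb]).  As e decreases to 0, the correction term on the left
vanishes because of its factor e, and log(1 + e f) / e converges to f
(lemma [cvg_ln_slope]).  The graph is finite, so the Laplacian and Gamma are
continuous for pointwise convergence ([cvg_laplacian], [cvg_Gamma]), and the
limit of the inequality is CD(d, K) for f. *)

Set Implicit Arguments.
Unset Strict Implicit.
Unset Printing Implicit Defensive.

Import Order.TTheory GRing.Theory Num.Theory.
Import numFieldNormedType.Exports.

Local Open Scope classical_set_scope.
Local Open Scope ring_scope.

(** * Behaviour of the gradient forms under affine substitutions *)

Section Affine.
Context {R : realType} {V : finType} (E : rel V).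
Implicit Types f g F G : V -> R.

(** The affine relation is a pointwise hypothesis, here and in the analogous
lemmas for the gradient forms, so that it can be supplied for functions that
are affine in f only after a computation, such as the Laplacian of 1 + e f. *)
Lemma laplacian_affine (a c : R) f F :
  (forall u, F u = a + c * f u) ->
  forall v, laplacian E F v = c * laplacian E f v.
Proof.
move=> FE v; rewrite /laplacian mulr_sumr; apply: eq_bigr => w _.
by rewrite !FE; ring.
Qed.

Lemma GammaE f g v :
  Gamma E f g v = (\sum_(w | E v w) (f w - f v) * (g w - g v)) / 2.
Proof.
rewrite /Gamma /laplacian !mulr_sumr -!sumrB; congr (_ / 2).
by apply: eq_bigr => w _; ring.
Qed.

Lemma Gamma_affine (a b c e : R) f g F G :
  (forall u, F u = a + c * f u) -> (forall u, G u = b + e * g u) ->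
  forall v, Gamma E F G v = c * e * Gamma E f g v.
Proof.
move=> FE GE v; rewrite !GammaE mulrA mulr_sumr; congr (_ / 2).
by apply: eq_bigr => w _; rewrite !FE !GE; ring.
Qed.

Lemma Gamma2_affine (a c : R) f F :
  (forall u, F u = a + c * f u) ->
  forall v, Gamma2 E F F v = c ^+ 2 * Gamma2 E f f v.
Proof.
move=> FE v; rewrite /Gamma2.
have lapE u : laplacian E F u = 0 + c * laplacian E f u.
  by rewrite add0r (laplacian_affine FE).
have gamE u : Gamma E F F u = 0 + c * c * Gamma E f f u.
  by rewrite add0r (Gamma_affine FE FE).
by rewrite (laplacian_affine gamE) (Gamma_affine FE lapE); ring.
Qed.

End Affine.

(** * Continuity for pointwise convergence *)

Section Continuity.
Context {R : realType} {V : finType} (E : rel V).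
Context {T : Type} (N : set_system T) {FN : Filter N}.
Implicit Types (f g : V -> R) (F G : T -> V -> R).

Lemma cvg_laplacian F f :
  (forall u, F t u @[t --> N] --> f u) ->
  forall v, laplacian E (F t) v @[t --> N] --> laplacian E f v.
Proof.
move=> Ff v; apply: cvg_big => [|w _]; first exact: add_continuous.
by apply: cvgB.
Qed.

Lemma cvg_Gamma F G f g :
  (forall u, F t u @[t --> N] --> f u) ->
  (forall u, G t u @[t --> N] --> g u) ->
  forall v, Gamma E (F t) (G t) v @[t --> N] --> Gamma E f g v.
Proof.
move=> Ff Gg v; rewrite /Gamma; apply: cvgM; last exact: cvg_cst.
apply: cvgB; last by apply: cvgM => //; exact: cvg_laplacian.
apply: cvgB; last by apply: cvgM => //; exact: cvg_laplacian.
by apply: cvg_laplacian => u; apply: cvgM.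
Qed.

End Continuity.

(** * The limit at the constant function 1 *)

Section Perturbation.
Context {R : realType}.

Lemma cvg_affine0 (c : R) : 1 + e * c @[e --> 0^'+] --> (1 : R).
Proof.
rewrite -[X in _ --> X](_ : 1 + 0 * c = 1); last by rewrite mul0r addr0.
apply: cvg_at_right_filter; apply: cvgD; first exact: cvg_cst.
by apply: cvgM; [exact: cvg_id | exact: cvg_cst].
Qed.

Lemma near_affine_gt0 (c : R) : \forall e \near 0^'+, 0 < 1 + e * c.
Proof. exact: cvgr_gt (cvg_affine0 c) _ ltr01. Qed.

(** The lower bound is the upper bound log(1 + y) <= y read at the inverse
1 / (1 + x) = 1 + (- x / (1 + x)). *)
Lemma ln1D_bounds (x : R) : 0 < 1 + x -> x / (1 + x) <= ln (1 + x) <= x.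
Proof.
move=> x1; apply/andP; split; last by apply: le_ln1Dx; lra.
have invE : (1 + x)^-1 = 1 + - (x / (1 + x)) by field; lra.
rewrite -lerN2 -lnV ?posrE // {1}invE; apply: le_ln1Dx.
by move: x1; rewrite -invr_gt0 {1}invE; lra.
Qed.

Lemma cvg_ln_slope (c : R) : ln (1 + e * c) / e @[e --> 0^'+] --> c.
Proof.
apply: (@squeeze_cvgr _ _ _ _ (fun e => c / (1 + e * c)) (fun=> c)).
- near=> e.
  have e0 : 0 < e by near: e; exact: nbhs_right_gt.
  have ec : 0 < 1 + e * c by near: e; exact: near_affine_gt0.
  rewrite ler_pdivlMr // ler_pdivrMr // [c * e]mulrC.
  by rewrite mulrAC [c * e]mulrC; exact: ln1D_bounds.
- rewrite -[X in _ --> X](_ : c / 1 = c); last by rewrite divr1.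
  apply: cvgM; first exact: cvg_cst.
  by apply: cvgV; [exact: oner_neq0 | exact: cvg_affine0].
- exact: cvg_cst.
Unshelve. all: by end_near.
Qed.

Context {V : finType} (E : rel V).

(** Every term of CDE' at 1 + e f carries a factor e^2, and the correction
term Gamma(1 + e f, Gamma(1 + e f) / (1 + e f)) even carries e^3: one e from
its first argument and e^2 from the inner Gamma.  Dividing by e^2 leaves an
inequality whose terms all converge as e tends to 0. *)
Lemma CDE'_perturb (d K : R) (f : V -> R) (e : R) v :
  CDE' E d K -> 0 < e -> (forall u, 0 < 1 + e * f u) ->
  1 / d * (1 + e * f v) ^+ 2
      * laplacian E (fun u => ln (1 + e * f u) / e) v ^+ 2
    + K * Gamma E f f v
  <= Gamma2 E f f v - e * Gamma E f (fun u => Gamma E f f u / (1 + e * f u)) v.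
Proof.
move=> cde e0 fpos; have := cde _ fpos v; rewrite /tGamma2.
set F := fun u => 1 + e * f u.
have FE u : F u = 1 + e * f u by [].
have LnE u : ln (F u) = 0 + e * (ln (1 + e * f u) / e).
  by rewrite add0r mulrC divfK // gt_eqF.
have QE u : Gamma E F F u / F u = 0 + e * e * (Gamma E f f u / (1 + e * f u)).
  by rewrite add0r (Gamma_affine E FE FE) mulrA.
rewrite (Gamma2_affine E FE) (laplacian_affine E LnE).
rewrite (Gamma_affine E FE QE) (Gamma_affine E FE FE) => ineq.
rewrite -(ler_pM2l (exprn_gt0 2 e0)).
by move: ineq; rewrite /F; lra.
Qed.

End Perturbation.

Theorem corollary3p3 (R : realType) (V : finType) (E : rel V)
  (E_sym : symmetric E) (E_irr : irreflexive E)
  (d K : R) (d_gt0 : 0 < d) :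
  CDE' E d K -> CD E d K.
Proof.
move=> cde f v.
have Q_cvg u : Gamma E f f u / (1 + e * f u) @[e --> 0^'+] --> Gamma E f f u.
  rewrite -[X in _ --> X](_ : Gamma E f f u / 1 = _); last by rewrite divr1.
  apply: cvgM; first exact: cvg_cst.
  by apply: cvgV; [exact: oner_neq0 | exact: cvg_affine0].
have -> : 1 / d = 1 / d * 1 ^+ 2 by rewrite expr1n mulr1.
rewrite -[Gamma2 E f f v]subr0 -(mul0r (Gamma E f (Gamma E f f) v)).
apply: (@ler_cvg_to _ (0 : R)^'+ _ R
  (fun e => 1 / d * (1 + e * f v) ^+ 2
      * laplacian E (fun u => ln (1 + e * f u) / e) v ^+ 2
    + K * Gamma E f f v)
  (fun e => Gamma2 E f f v
    - e * Gamma E f (fun u => Gamma E f f u / (1 + e * f u)) v)).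
- apply: cvgD; last exact: cvg_cst.
  apply: cvgM.
    apply: cvgM; first exact: cvg_cst.
    by apply: cvgM; exact: cvg_affine0.
  by apply: cvgM; apply: cvg_laplacian => u; exact: cvg_ln_slope.
- apply: cvgB; first exact: cvg_cst.
  apply: cvgM; first by apply: cvg_at_right_filter; exact: cvg_id.
  by apply: cvg_Gamma => // u; exact: cvg_cst.
- near=> e; apply: CDE'_perturb => //.
  by near: e; apply: filter_forall => u; exact: near_affine_gt0.
Unshelve. all: by end_near.
Qed.
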